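(* Let $S \subseteq \mathbb{N}$ be a set containing infinitely many prime numbers $p$ with $p \equiv 1 \pmod 4$, and let $K = \mathbb{Q}(\sqrt{n} \mid n \in S)$. Then $P(\mathcal{O}_K) = \infty$.
   Context: For a commutative ring $R$ and $n \in \mathbb{N}$, let $\Sigma^n R^2 = \{x_1^2 + \cdots + x_n^2 \mid x_1, \ldots, x_n \in R\}$. The Pythagoras number of $R$ is $P(R) = \inf\{n \in \mathbb{N} \mid \Sigma^n R^2 = \Sigma^{n+1} R^2\} \in \mathbb{N} \cup \{\infty\}$. For an algebraic extension $K/\mathbb{Q}$ (possibly of infinite degree), $\mathcal{O}_K$ denotes its ring of integers, i.e. the integral closure of $\mathbb{Z}$ in $K$. *)

(* Defs.v *)
From HB Require Import structures.
From mathcomp Require Import all_boot all_order all_algebra all_field.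
From mathcomp Require Import boolp classical_sets.

Set Implicit Arguments.
Unset Strict Implicit.
Unset Printing Implicit Defensive.

Import GRing.Theory Num.Theory.

Local Open Scope classical_set_scope.
Local Open Scope ring_scope.

Definition sum_sq (R : comPzRingType) (n : nat) : set R :=
  [set y | exists x : 'I_n -> R, y = \sum_(i < n) x i ^+ 2].
Arguments sum_sq R n : clear implicits.

(* Values in N u {oo}: [Some n] is the natural number n and [None] is oo,
   the infimum of the empty set. *)
Definition pythagoras_number (R : comPzRingType) : option nat :=
  match pselect (exists n, `[< sum_sq R n = sum_sq R n.+1 >]) with
  | left h => Some (ex_minn h)
  | right _ => None
  end.

Definition integral_closure_pred (L : fieldType) : {pred L} :=
  fun x => `[< integralOver (intr : int -> L) x >].
Arguments integral_closure_pred L : clear implicits.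

Fact integral_closure_subring (L : fieldType) :
  subring_closed (integral_closure_pred L).
Proof.
split=> [|x y /asboolP ix /asboolP iy|x y /asboolP ix /asboolP iy].
- by apply/asboolP; exact: integral1.
- by apply/asboolP; exact: integral_sub.
- by apply/asboolP; exact: integral_mul.
Qed.

HB.instance Definition _ (L : fieldType) :=
  GRing.isSubringClosed.Build L (integral_closure_pred L)
    (integral_closure_subring L).

Definition ring_of_integers (L : fieldType) : Type :=
  {x : L | x \in integral_closure_pred L}.

HB.instance Definition _ (L : fieldType) :=
  SubChoice.on (ring_of_integers L).
HB.instance Definition _ (L : fieldType) :=
  [SubChoice_isSubComNzRing of ring_of_integers L by <:].

(* The subfields of algC are the sets that contain 1 and are closed under
   subtraction and division (in algC, x / 0 = 0);
   the intersection of those containing A is Q(A). *)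
Definition generated_subfield (A : set algC) : {pred algC} :=
  fun x => `[< forall F : {pred algC}, divring_closed F ->
                 (forall a, A a -> a \in F) -> x \in F >].

Fact generated_subfield_divring (A : set algC) :
  divring_closed (generated_subfield A).
Proof.
split=> [|x y /asboolP xA /asboolP yA|x y /asboolP xA /asboolP yA];
  apply/asboolP => F cF AF; have [F1 FB FV] := cF.
- exact: F1.
- by apply: FB; [exact: xA|exact: yA].
- by apply: FV; [exact: xA|exact: yA].
Qed.

HB.instance Definition _ (A : set algC) :=
  GRing.isDivringClosed.Build algC (generated_subfield A)
    (generated_subfield_divring A).

Definition rat_adjoin (A : set algC) : Type :=
  {x : algC | x \in generated_subfield A}.

HB.instance Definition _ (A : set algC) := SubChoice.on (rat_adjoin A).
HB.instance Definition _ (A : set algC) :=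
  [SubChoice_isSubComUnitRing of rat_adjoin A by <:].
HB.instance Definition _ (A : set algC) :=
  [SubComUnitRing_isSubIntegralDomain of rat_adjoin A by <:].
HB.instance Definition _ (A : set algC) :=
  [SubIntegralDomain_isSubField of rat_adjoin A by <:].

Definition multiquadratic_field (S : set nat) : fieldType :=
  rat_adjoin [set sqrtC (n%:R : algC) | n in S].

(* Main.v *)
Require Import Defs.
From HB Require Import structures.
From mathcomp Require Import all_boot all_order all_algebra all_field.
From mathcomp Require Import boolp classical_sets cardinality.
From mathcomp Require Import ring.

(* Choose primes p_1, ..., p_n in S, congruent to 1 mod 4, each larger than
   1 + 4 times the sum of the preceding ones. Then the sum b of the squares of
   the (1 + sqrt p_i) / 2 is not a sum of fewer than n squares of algebraic
   integers x_j of K. With p = p_n, and F generated by the square roots of the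
   naturals prime to p, write x_j = (u_j + w_j sqrt p) / 2 with u_j, w_j in F;
   since p is unramified in F, each w_j is an algebraic integer. Comparing
   components, sum (u_j^2 + p w_j^2) = 4 b' + 1 + p and sum u_j w_j = 1, where
   b' is the sum for p_1, ..., p_(n-1). All conjugates of u_j, w_j are real and
   those of 4 b' + 1 are less than p, so the sum of the w_j^2 has all its
   conjugates less than 2. A nonzero algebraic integer has a conjugate of
   modulus at least 1; applied to w_i w_j and to w_i^2 - 1, this shows that
   exactly one w_i is nonzero, and w_i^2 = 1. Hence
   x_i^2 = ((1 + sqrt p) / 2)^2, and one concludes by induction on n. *)

Set Implicit Arguments.
Unset Strict Implicit.
Unset Printing Implicit Defensive.

Import Order.TTheory GRing.Theory Num.Theory.

Local Open Scope ring_scope.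

(** * Conjugates of algebraic numbers and of algebraic integers *)

(** The map from Q(y) to Q(z) sending [y] to [z] extends to the number field [Qr] generated by all
    roots of the minimal polynomial, which is a splitting field, and from there to [algC]. *)
Lemma root_minCpoly_aut (y z : algC) :
  root (minCpoly y) z -> exists nu : {rmorphism algC -> algC}, nu y = z.
Proof.
have [p [Dp mon_p] dv_p] := minCpolyP y.
have [r Dr] := closed_field_poly_normal (minCpoly y : {poly algC}).
rewrite (monicP (minCpoly_monic y)) scale1r in Dr.
have := root_minCpoly y; rewrite {1}Dr root_prod_XsubC => r_y pz0.
have := pz0; rewrite Dr root_prod_XsubC => r_z.
have [Qr [QrC [rr Drr genQr]]] := num_field_exists r.
have [yy _ Dyy] : exists2 yy, yy \in rr & QrC yy = y.
  by move: r_y; rewrite -Drr => /mapP[yy]; exists yy.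
have [zz _ Dzz] : exists2 zz, zz \in rr & QrC zz = z.
  by move: r_z; rewrite -Drr => /mapP[zz]; exists zz.
have hom1 : kHom 1 1 (\1%VF : 'End(Qr)) by rewrite kHom1.
have map1 (q : {poly Qr}) : map_poly \1%VF q = q.
  by rewrite map_poly_id // => a _; rewrite id_lfunE.
have QrCQ (q : {poly rat}) :
    map_poly QrC (map_poly (in_alg Qr) q) = map_poly ratr q.
  rewrite -map_poly_comp; apply: eq_map_poly => a.
  by rewrite /= rmorphZ_num rmorph1 mulr1.
have min_zz : root (map_poly \1%VF (minPoly 1 yy)) zz.
  rewrite map1.
  have [q Dq] : exists q : {poly rat}, minPoly 1 yy = map_poly (in_alg Qr) q.
    by apply/polyOver1P; exact: minPolyOver.
  have : root (map_poly QrC (minPoly 1 yy)) y.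
    by rewrite -Dyy fmorph_root root_minPoly.
  rewrite -(fmorph_root QrC) Dzz {}Dq QrCQ dv_p => /dvdpP[s ->].
  rewrite rmorphM rootM; apply/orP; right; by rewrite Dp in pz0.
(* The embedding of Q(yy) into [Qr] with [yy] sent to [zz]. *)
have homE := kHomExtendP (sub1v _) hom1 min_zz.
pose pr := map_poly (in_alg Qr) p.
have Qpr : pr \is a polyOver 1%VS.
  by apply/polyOverP=> i; rewrite coef_map memvZ ?memv_line.
have splitQr : splittingFieldFor <<1; yy>>%VS pr fullv.
  apply: splittingFieldForS (sub1v _) (subvf _) _; exists rr => //.
  congr (_ %= _) : (eqpxx pr); apply/(map_poly_inj QrC).
  rewrite QrCQ -[LHS]Dp Dr -Drr big_map rmorph_prod /=; apply: eq_bigr => t _.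
  by rewrite map_polyXsubC.
have [f hom_f Df] := kHom_extends (sub1v _) homE Qpr splitQr.
pose fmM := GRing.isMonoidMorphism.Build _ _ f (kHom_monoid_morphism hom_f).
pose phi : {rmorphism Qr -> Qr} := HB.pack (fun_of_lfun f) fmM.
have [nu Dnu] := extend_algC_subfield_aut QrC phi.
exists nu; rewrite -Dyy -Dnu /= -Df ?memv_adjoin //.
by rewrite (kHomExtend_val hom1 min_zz).
Qed.

(** The roots of the minimal polynomial are conjugates of [y], and their product is up to sign its
    constant coefficient, a nonzero rational integer; so they cannot all have modulus below 1. *)
Lemma Aint_aut_norm_ge1 (y : algC) :
  y \in Aint -> y != 0 -> exists nu : {rmorphism algC -> algC}, 1 <= `|nu y|.
Proof.
move=> Zy nz_y.
have [r Dr] := closed_field_poly_normal (minCpoly y : {poly algC}).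
rewrite (monicP (minCpoly_monic y)) scale1r in Dr.
have aut_r z : z \in r -> exists nu : {rmorphism algC -> algC}, nu y = z.
  by move=> r_z; apply: root_minCpoly_aut; rewrite Dr root_prod_XsubC.
have norm_prod : 1 <= \prod_(z <- r) `|z|.
  have -> : \prod_(z <- r) `|z| = `|(minCpoly y).[0]|.
    rewrite Dr horner_prod normr_prod; apply: eq_bigr => z _.
    by rewrite !hornerE normrN.
  apply: norm_intr_ge1; first by rewrite horner_coef0; apply: (polyOverP Zy).
  apply/negP; rewrite -/(root _ 0) => /root_minCpoly_aut[nu /eqP].
  by rewrite fmorph_eq0 (negPf nz_y).
have [/allP lt1 | /allPn[z r_z]] := boolP (all (fun z => `|z| < 1) r); last first.
  rewrite -real_leNgt ?normr_real ?real1 // => z_ge1.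
  by have [nu Dnu] := aut_r z r_z; exists nu; rewrite Dnu.
suff : \prod_(z <- r) `|z| < 1 by move/(le_lt_trans norm_prod); rewrite ltxx.
(* The strict inequality needs at least one factor. *)
have : r != [::].
  apply/eqP => r0; have := size_minCpoly y.
  by rewrite Dr r0 big_nil size_poly1.
case: r lt1 {Dr aut_r norm_prod} => // z r lt1 _; rewrite big_cons.
rewrite (le_lt_trans _ (lt1 z (mem_head z r))) // ler_piMr //.
elim: r lt1 => [|t r IHr] lt1; first by rewrite big_nil.
rewrite big_cons mulr_ile1 ?prodr_ge0 //.
  by rewrite ltW ?lt1 ?inE ?eqxx ?orbT.
by apply: IHr => s; rewrite inE => /orP[/eqP-> | r_s];
  rewrite lt1 ?inE ?eqxx ?r_s ?orbT.
Qed.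

(** * Quadratic extensions inside [algC] *)

(** For a subfield [F] containing [s ^+ 2] this is F(s), including the degenerate case where [s]
    lies in [F]. *)
Definition quad_adjoin (F : {pred algC}) (s : algC) : {pred algC} :=
  fun x => `[< exists a b, [/\ a \in F, b \in F & x = a + b * s] >].

Lemma quad_adjoinP (F : {pred algC}) (s x : algC) :
  reflect (exists a b, [/\ a \in F, b \in F & x = a + b * s])
          (x \in quad_adjoin F s).
Proof. exact: asboolP. Qed.

Section QuadraticExtension.
Variables (F : divringClosed algC) (s : algC).
Hypothesis Fss : s ^+ 2 \in F.

Lemma mem_quad_adjoin x : x \in F -> x \in quad_adjoin F s.
Proof.
by move=> Fx; apply/quad_adjoinP; exists x, 0; rewrite rpred0 mul0r addr0.
Qed.

Lemma gen_quad_adjoin : s \in quad_adjoin F s.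
Proof. by apply/quad_adjoinP; exists 0, 1; rewrite rpred0 rpred1 mul1r add0r. Qed.

Lemma quad_adjoin_divring : divring_closed (quad_adjoin F s).
Proof.
have memM x y : x \in quad_adjoin F s -> y \in quad_adjoin F s ->
    x * y \in quad_adjoin F s.
  move=> /quad_adjoinP[a [b [Fa Fb ->]]] /quad_adjoinP[c [d [Fc Fd ->]]].
  apply/quad_adjoinP; exists (a * c + b * d * s ^+ 2), (a * d + b * c).
  by split; rewrite ?(Fss, rpredD, rpredM) //; ring.
split=> [|x y|x y Kx Ky]; first by rewrite mem_quad_adjoin ?rpred1.
  move=> /quad_adjoinP[a [b [Fa Fb ->]]] /quad_adjoinP[c [d [Fc Fd ->]]].
  apply/quad_adjoinP; exists (a - c), (b - d).
  by split; rewrite ?rpredB //; ring.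
apply: memM => //; case/quad_adjoinP: Ky => a [b [Fa Fb ->]].
have [b0 | nz_b] := eqVneq b 0.
  by rewrite mem_quad_adjoin // b0 mul0r addr0 rpredV.
(* If [s] lies in [F], the norm [N] below could vanish; otherwise the inverse is the conjugate
   divided by [N]. *)
have [Fs | notFs] := boolP (s \in F).
  by rewrite mem_quad_adjoin // rpredV rpredD ?rpredM.
have nz_1 : a + b * s != 0.
  apply: contraNneq notFs => /eqP; rewrite addr_eq0 => /eqP Da.
  have -> : s = - a / b by rewrite Da; field.
  by rewrite rpred_div ?rpredN.
have nz_2 : a - b * s != 0.
  apply: contraNneq notFs => /eqP; rewrite subr_eq0 => /eqP Da.
  have -> : s = a / b by rewrite Da; field.
  by rewrite rpred_div.
pose N := a ^+ 2 - b ^+ 2 * s ^+ 2.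
have DN : N = (a + b * s) * (a - b * s) by rewrite /N; ring.
have nz_N : N != 0 by rewrite DN mulf_neq0.
apply/quad_adjoinP; exists (a / N), (- b / N).
have FN : N \in F.
  by apply: rpredB; [exact: rpredX | apply: rpredM => //; exact: rpredX].
split; rewrite ?rpred_div ?rpredN //.
by rewrite DN; field; rewrite nz_1 nz_2.
Qed.

Hypothesis notFs : s \notin F.

Lemma quad_adjoin_eq0 a b : a \in F -> b \in F -> a + b * s = 0 -> a = 0 /\ b = 0.
Proof.
move=> Fa Fb ab0; have [b0 | nz_b] := eqVneq b 0.
  by move: ab0; rewrite b0 mul0r addr0.
case/negP: notFs; have -> : s = - a / b.
  by move/eqP: ab0; rewrite addr_eq0 => /eqP->; field.
by rewrite rpred_div ?rpredN.
Qed.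

(** A rational polynomial takes values A + B s and A - B s at the two conjugates, with the same A, B
    in [F]; so it vanishes at both or at neither. *)
Lemma Aint_quad_conj a b :
  a \in F -> b \in F -> a + b * s \in Aint -> a - b * s \in Aint.
Proof.
move=> Fa Fb Zab; have [p [Dp mon_p] _] := minCpolyP (a + b * s).
have horner_conj (q : {poly rat}) : exists A B, [/\ A \in F, B \in F,
    (map_poly ratr q).[a + b * s] = A + B * s &
    (map_poly ratr q).[a - b * s] = A - B * s].
  elim/poly_ind: q => [|q c [A [B [FA FB Dq Dq']]]].
    by exists 0, 0; rewrite rmorph0 !horner0 rpred0 mul0r addr0 subr0.
  have Dr t : (map_poly ratr (q * 'X + c%:P)).[t]
      = (map_poly ratr q).[t] * t + ratr c :> algC.
    by rewrite rmorphD rmorphM /= map_polyX map_polyC /= !hornerE.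
  have Fc : ratr c \in F by apply: rpred_Crat; exact: Crat_rat.
  exists (A * a + B * b * s ^+ 2 + ratr c), (A * b + B * a).
  rewrite !Dr Dq Dq'; split; [|by rewrite rpredD // rpredM|by ring|by ring].
  by rewrite rpredD // rpredD // rpredM // rpredM.
have [A [B [FA FB Dpx Dpx']]] := horner_conj p.
have px0 : A + B * s = 0.
  by rewrite -Dpx; apply/rootP; have := root_minCpoly (a + b * s); rewrite Dp.
have [A0 B0] := quad_adjoin_eq0 FA FB px0.
apply: (@root_monic_Aint (minCpoly (a + b * s))) => //; last exact: minCpoly_monic.
by rewrite Dp; apply/rootP; rewrite Dpx' A0 B0 mul0r subr0.
Qed.

End QuadraticExtension.

(** * Integers whose square is divisible by p *)

Lemma Aint_sqrtC_nat n : sqrtC n%:R \in Aint.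
Proof.
apply: (@root_monic_Aint ('X^2 - n%:R%:P)).
- by apply/rootP; rewrite !hornerE sqrtCK subrr.
- by rewrite monicXnsubC.
- apply/polyOverP=> i; rewrite coefB coefXn coefC rpredB ?rpred_nat //.
  by rewrite -mulrb rpredMn ?rpred_nat.
Qed.

(** For a subfield [F] with ring of integers O and a prime [p]: O/pO has no nonzero nilpotents, an
    elementary form of [p] being unramified in [F]. *)
Definition reduced_mod (p : nat) (F : {pred algC}) :=
  forall y, y \in F -> y \in Aint -> y ^+ 2 / p%:R \in Aint -> y / p%:R \in Aint.

(** By a Bezout relation u m = v p + 1, y/p is the combination u (m y/p) - v y. *)
Lemma Aint_coprime_div (m p : nat) (y : algC) : (0 < p)%N ->
  coprime m p -> y \in Aint -> m%:R * (y / p%:R) \in Aint -> y / p%:R \in Aint.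
Proof.
move=> p_gt0 co_m_p Zy Zmy; have [m0 | m_gt0] := posnP m.
  by move: co_m_p; rewrite m0 /coprime gcd0n => /eqP->; rewrite divr1.
case: (egcdnP p m_gt0) => u v Duv _; move: Duv; rewrite (eqP co_m_p) => Duv.
have nz_p : p%:R != 0 :> algC by rewrite pnatr_eq0 -lt0n.
have -> : y / p%:R = u%:R * (m%:R * (y / p%:R)) - v%:R * y.
  have : u%:R * m%:R = v%:R * p%:R + 1 :> algC by rewrite -!natrM Duv natrD.
  move=> Dum; rewrite mulrA Dum; by field.
apply: rpredB; last by rewrite rpredM ?rpred_nat.
by apply: rpredM Zmy; exact: rpred_nat.
Qed.

Lemma reduced_mod_Crat p : prime p -> reduced_mod p Crat.
Proof.
move=> p_pr y Qy Zy Zyy.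
have nz_p : p%:R != 0 :> algC by rewrite pnatr_eq0 -lt0n prime_gt0.
have /intrP[m Dm] := Cint_rat_Aint Qy Zy.
have /intrP[k Dk] : y ^+ 2 / p%:R \in Num.int.
  by apply: Cint_rat_Aint => //; rewrite rpred_div ?rpredX ?rpred_nat.
have : (p %| `|m| ^ 2)%N.
  have /eqP : m ^+ 2 = k * p%:Z.
    by apply: (@intr_inj algC); rewrite rmorphXn rmorphM /= -Dm -Dk; field.
  by move/eqP => Dm2; rewrite -abszX Dm2 abszM /= dvdn_mull.
rewrite Euclid_dvdX // => /andP[/(@dvdzP p m)[q Dq] _].
by rewrite Dm Dq rmorphM /= mulfK // Aint_int.
Qed.

(* With y' the conjugate of y, the traces y + y' and (y - y') s lie in F, and
   their squares are divisible by p as soon as y^2, y'^2 and y y' are; for y y'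
   this is the hypothesis on F, since (y y')^2 = y^2 y'^2. *)
Lemma reduced_mod_quad (F : divringClosed algC) p n : prime p -> odd p ->
  ~~ (p %| n)%N -> reduced_mod p F -> reduced_mod p (quad_adjoin F (sqrtC n%:R)).
Proof.
move=> p_pr p_odd p'n redF y Ky Zy Zyy; set s := sqrtC n%:R in Ky *.
have nz_p : p%:R != 0 :> algC by rewrite pnatr_eq0 -lt0n prime_gt0.
have Dss : s ^+ 2 = n%:R by rewrite sqrtCK.
have Fss : s ^+ 2 \in F by rewrite Dss rpred_nat.
have Zs : s \in Aint by apply: Aint_sqrtC_nat.
case/quad_adjoinP: Ky => a [b [Fa Fb Dy]].
have [Fs | notFs] := boolP (s \in F).
  by apply: redF => //; rewrite Dy rpredD ?rpredM.
pose y' := a - b * s.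
have Zy' : y' \in Aint by apply: (Aint_quad_conj Fss notFs) => //; rewrite -Dy.
(* This is the conjugate of the integer y^2/p. *)
have Zyy' : y' ^+ 2 / p%:R \in Aint.
  have -> : y' ^+ 2 / p%:R
      = (a ^+ 2 + b ^+ 2 * s ^+ 2) / p%:R - (a * b *+ 2 / p%:R) * s.
    by rewrite /y'; field.
  apply: (Aint_quad_conj Fss notFs).
  - by rewrite rpred_div ?rpred_nat // rpredD ?rpredX // rpredM // rpredX.
  - by rewrite rpred_div ?rpred_nat // rpredMn // rpredM.
  - suff <- : y ^+ 2 / p%:R
      = (a ^+ 2 + b ^+ 2 * s ^+ 2) / p%:R + (a * b *+ 2 / p%:R) * s by [].
    by rewrite Dy; field.
have ZN : y * y' / p%:R \in Aint.
  apply: redF.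
  - have -> : y * y' = a ^+ 2 - b ^+ 2 * s ^+ 2 by rewrite Dy /y'; ring.
    by rewrite rpredB ?rpredX // rpredM // rpredX.
  - by rewrite rpredM.
  - have -> : (y * y') ^+ 2 / p%:R = y ^+ 2 / p%:R * y' ^+ 2 by field.
    by rewrite rpredM ?rpredX.
have ZT : (y + y') / p%:R \in Aint.
  apply: redF.
  - have -> : y + y' = a *+ 2 by rewrite Dy /y'; ring.
    by rewrite rpredMn.
  - by rewrite rpredD.
  - have -> : (y + y') ^+ 2 / p%:R
      = y ^+ 2 / p%:R + y' ^+ 2 / p%:R + y * y' / p%:R *+ 2 by field.
    by rewrite ?rpredD ?rpredMn.
have ZD : (y - y') * s / p%:R \in Aint.
  apply: redF.
  - have -> : (y - y') * s = b * s ^+ 2 *+ 2 by rewrite Dy /y'; ring.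
    by rewrite rpredMn // rpredM.
  - apply: rpredM => //; exact: rpredB.
  - have -> : ((y - y') * s) ^+ 2 / p%:R
      = (y ^+ 2 / p%:R + y' ^+ 2 / p%:R - y * y' / p%:R *+ 2) * s ^+ 2 by field.
    apply: rpredM; last exact: rpredX.
    by apply: rpredB; [exact: rpredD | exact: rpredMn].
(* The two traces recover 2 n y = n (y + y') + ((y - y') s) s, and 2 n is prime to [p]. *)
apply: (@Aint_coprime_div (2 * n)) => //; first exact: prime_gt0.
  by rewrite coprimeMl coprime2n p_odd coprime_sym prime_coprime.
have -> : (2 * n)%:R * (y / p%:R)
    = n%:R * ((y + y') / p%:R) + (y - y') * s / p%:R * s.
  by rewrite natrM -Dss; field.
by apply: rpredD; apply: rpredM => //; exact: rpred_nat.
Qed.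

(** * Towers of square roots, and the field of square roots of naturals prime to p *)

Fixpoint quad_tower (ns : seq nat) : {pred algC} :=
  if ns is n :: ns' then quad_adjoin (quad_tower ns') (sqrtC n%:R) else Crat.

Fact quad_tower_divring ns : divring_closed (quad_tower ns).
Proof.
elim: ns => [|n ns IHns] /=; first exact: Crat_divring_closed.
pose DivM := GRing.isDivringClosed.Build algC (quad_tower ns) IHns.
pose F : divringClosed algC := HB.pack (quad_tower ns) DivM.
by apply: (@quad_adjoin_divring F); rewrite sqrtCK rpred_nat.
Qed.
HB.instance Definition _ ns :=
  GRing.isDivringClosed.Build algC (quad_tower ns) (quad_tower_divring ns).

Lemma quad_tower_catl ns ms : {subset quad_tower ns <= quad_tower (ns ++ ms)}.
Proof.
elim: ns => [|n ns IHns] x /=; first exact: rpred_Crat.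
case/quad_adjoinP=> a [b [Fa Fb ->]].
by apply/quad_adjoinP; exists a, b; rewrite !IHns.
Qed.

Lemma quad_tower_catr ns ms : {subset quad_tower ms <= quad_tower (ns ++ ms)}.
Proof.
by elim: ns => [|n ns IHns] x //= /IHns; apply: mem_quad_adjoin.
Qed.

Lemma reduced_mod_tower p ns : prime p -> odd p ->
  all (fun n => ~~ (p %| n)%N) ns -> reduced_mod p (quad_tower ns).
Proof.
move=> p_pr p_odd; elim: ns => [|n ns IHns] /=.
  by move=> _; exact: reduced_mod_Crat.
by case/andP=> p'n /IHns; apply: reduced_mod_quad.
Qed.

(** The tower is totally real, since [nu] sends each square root of a natural, itself real, to plus
    or minus itself. *)
Lemma quad_tower_real ns (nu : {rmorphism algC -> algC}) x :
  x \in quad_tower ns -> nu x \is Num.real.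
Proof.
elim: ns x => [|n ns IHns] x /=.
  by move=> Qx; rewrite aut_Crat // Creal_Crat.
case/quad_adjoinP=> a [b [/IHns Ra /IHns Rb ->]].
rewrite rmorphD rmorphM rpredD ?rpredM //.
have : nu (sqrtC n%:R) ^+ 2 = sqrtC n%:R ^+ 2 by rewrite -rmorphXn sqrtCK rmorph_nat.
have Rn : (sqrtC n%:R : algC) \is Num.real.
  by rewrite sqrtC_real ?ler0n.
by move/eqP; rewrite eqf_sqr => /pred2P[]->; rewrite ?rpredN.
Qed.

(* For p prime: the field generated by the square roots of all naturals prime to p. *)
Definition coprime_quad (p : nat) : {pred algC} :=
  fun x => `[< exists2 ns, all (fun n => ~~ (p %| n)%N) ns & x \in quad_tower ns >].

Lemma coprime_quadP p x :
  reflect (exists2 ns, all (fun n => ~~ (p %| n)%N) ns & x \in quad_tower ns)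
          (x \in coprime_quad p).
Proof. exact: asboolP. Qed.

Fact coprime_quad_divring p : divring_closed (coprime_quad p).
Proof.
split=> [|x y|x y]; first by apply/coprime_quadP; exists [::]; rewrite ?rpred1.
  case/coprime_quadP=> ns p'ns Fx /coprime_quadP[ms p'ms Fy].
  apply/coprime_quadP; exists (ns ++ ms); first by rewrite all_cat p'ns.
  by apply: rpredB; [exact: quad_tower_catl | exact: quad_tower_catr].
case/coprime_quadP=> ns p'ns Fx /coprime_quadP[ms p'ms Fy].
apply/coprime_quadP; exists (ns ++ ms); first by rewrite all_cat p'ns.
by apply: rpred_div; [exact: quad_tower_catl | exact: quad_tower_catr].
Qed.
HB.instance Definition _ p :=
  GRing.isDivringClosed.Build algC (coprime_quad p) (coprime_quad_divring p).

Lemma coprime_quad_sqrt p n : ~~ (p %| n)%N -> sqrtC n%:R \in coprime_quad p.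
Proof.
move=> p'n; apply/coprime_quadP; exists [:: n]; first by rewrite /= p'n.
exact: gen_quad_adjoin.
Qed.

Lemma reduced_mod_coprime_quad p : prime p -> odd p -> reduced_mod p (coprime_quad p).
Proof.
by move=> p_pr p_odd y /coprime_quadP[ns p'ns]; apply: reduced_mod_tower.
Qed.

Lemma coprime_quad_real p (nu : {rmorphism algC -> algC}) x :
  x \in coprime_quad p -> nu x \is Num.real.
Proof. by case/coprime_quadP=> ns _; apply: quad_tower_real. Qed.

(** Otherwise reducedness applied to sqrt p, whose square over p is 1, would make sqrt p / p
    integral, and hence its square 1/p. *)
Lemma sqrt_notin_coprime_quad p : prime p -> odd p -> sqrtC p%:R \notin coprime_quad p.
Proof.
move=> p_pr p_odd; apply/negP => Fs.
have nz_p : p%:R != 0 :> algC by rewrite pnatr_eq0 -lt0n prime_gt0.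
have := reduced_mod_coprime_quad p_pr p_odd Fs (Aint_sqrtC_nat p).
rewrite sqrtCK divff // => /(_ Aint1) Zs.
have : (p%:R^-1 : algC) \in Num.int.
  apply: Cint_rat_Aint; first by rewrite rpredV rpred_nat.
  have -> : p%:R^-1 = (sqrtC p%:R / p%:R) ^+ 2 :> algC.
    by rewrite expr_div_n sqrtCK expr2 invfM mulrA divff ?mul1r.
  by rewrite rpredX.
move/(norm_intr_ge1)/(_ _); rewrite invr_eq0 nz_p => /(_ isT).
rewrite normfV normr_nat invf_ge1 ?ltr0n ?prime_gt0 // lern1 leqNgt.
by rewrite prime_gt1.
Qed.

(** Each positive n is m p^k with m prime to p, so sqrt n is sqrt m times a power of sqrt p. *)
Lemma generated_sqrt_quad p (A : set nat) x : prime p ->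
  x \in generated_subfield [set sqrtC (n%:R : algC) | n in A]%classic ->
  x \in quad_adjoin (coprime_quad p) (sqrtC p%:R).
Proof.
move=> p_pr /asboolP; apply.
  by apply: (@quad_adjoin_divring (coprime_quad p)); rewrite sqrtCK rpred_nat.
move=> _ [n _ <-].
have Fpp : sqrtC p%:R ^+ 2 \in coprime_quad p by rewrite sqrtCK rpred_nat.
pose DivM := GRing.isDivringClosed.Build algC
  (quad_adjoin (coprime_quad p) (sqrtC p%:R)) (quad_adjoin_divring Fpp).
pose K : divringClosed algC :=
  HB.pack (quad_adjoin (coprime_quad p) (sqrtC p%:R)) DivM.
rewrite -[_ \in _]/(_ \in K).
have [-> | n_gt0] := posnP n; first by rewrite sqrtC0 rpred0.
have [m co_p_m ->] := pfactor_coprime p_pr n_gt0.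
rewrite natrM natrX sqrtCM ?nnegrE ?exprn_ge0 ?ler0n //.
apply: rpredM.
  apply: (@mem_quad_adjoin (coprime_quad p)).
  by apply: coprime_quad_sqrt; rewrite -prime_coprime.
elim: (logn p n) => [|k IHk]; first by rewrite sqrtC1 rpred1.
rewrite exprS sqrtCM ?nnegrE ?exprn_ge0 ?ler0n //.
by apply: rpredM => //; exact: (@gen_quad_adjoin (coprime_quad p)).
Qed.

(** * Sums of squares of integers of F(sqrt p) *)

(** For x = a + b s, the difference 2 b s of [x] and its conjugate is integral. Reducedness applied
    to y = 2 b p, where y^2/p = (2 b s)^2 p^0 up to rewriting s^2 = p, gives that w = 2 b is
    integral. *)
Lemma Aint_quad_coprime p x : prime p -> odd p ->
  x \in Aint -> x \in quad_adjoin (coprime_quad p) (sqrtC p%:R) ->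
  exists u w, [/\ u \in coprime_quad p, w \in coprime_quad p, w \in Aint &
                  x = (u + w * sqrtC p%:R) / 2].
Proof.
move=> p_pr p_odd Zx /quad_adjoinP[a [b [Fa Fb Dx]]].
set s := sqrtC p%:R in Dx *.
have nz_p : p%:R != 0 :> algC by rewrite pnatr_eq0 -lt0n prime_gt0.
have Dss : s ^+ 2 = p%:R by rewrite sqrtCK.
have Fss : s ^+ 2 \in coprime_quad p by rewrite Dss rpred_nat.
have notFs := sqrt_notin_coprime_quad p_pr p_odd.
have Zx' : a - b * s \in Aint.
  by apply: (@Aint_quad_conj (coprime_quad p)) => //; rewrite -Dx.
have Zv : b *+ 2 * s \in Aint.
  have -> : b *+ 2 * s = x - (a - b * s) by rewrite Dx; ring.
  exact: rpredB.
exists (a *+ 2), (b *+ 2).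
split; [by rewrite rpredMn | by rewrite rpredMn | | by rewrite Dx; field].
have -> : b *+ 2 = b *+ 2 * s ^+ 2 / p%:R by rewrite Dss mulfK.
apply: (reduced_mod_coprime_quad p_pr p_odd).
- by rewrite rpredM // rpredMn.
- rewrite expr2 mulrA; apply: rpredM => //; exact: Aint_sqrtC_nat.
- have -> : (b *+ 2 * s ^+ 2) ^+ 2 / p%:R = (b *+ 2 * s) ^+ 2.
    by rewrite -Dss; field; rewrite sqrtC_eq0.
  exact: rpredX.
Qed.

Lemma aut_sum_sqr_lt2 (p : nat) (beta : algC) (xs : seq algC)
    (u w : algC -> algC) (nu : {rmorphism algC -> algC}) :
  (0 < p)%N ->
  {in xs, forall x, u x \in coprime_quad p /\ w x \in coprime_quad p} ->
  \sum_(x <- xs) (u x ^+ 2 + w x ^+ 2 * p%:R) = beta *+ 4 + 1 + p%:R ->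
  nu beta *+ 4 + 1 < p%:R -> \sum_(x <- xs) nu (w x) ^+ 2 < 2.
Proof.
move=> p_gt0 Fuw Dsum lt_p.
have p_gt0C : 0 < p%:R :> algC by rewrite ltr0n.
rewrite -(ltr_pM2r p_gt0C) mulr_suml.
have sqr_ge0C t : t \in coprime_quad p -> 0 <= nu t ^+ 2.
  by move=> Ft; rewrite -realEsqr (coprime_quad_real nu Ft).
apply: (@le_lt_trans _ _ (nu beta *+ 4 + 1 + p%:R)); last first.
  by rewrite mulr_natl mulr2n ltrD2r.
have -> : nu beta *+ 4 + 1 + p%:R = nu (beta *+ 4 + 1 + p%:R).
  by rewrite !rmorphD !rmorphMn !rmorph1.
rewrite -Dsum rmorph_sum /= big_seq [leRHS]big_seq.
apply: ler_sum => x /Fuw[Fu Fw].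
by rewrite rmorphD (rmorphM nu (w x ^+ 2)) !rmorphXn rmorph_nat lerDr sqr_ge0C.
Qed.

(** The descent step: the entry [x0] is plus or minus (1 + sqrt p)/2, and its square cancels. *)
Lemma sum_sqr_rem_quad p (beta : algC) (xs : seq algC) :
    prime p -> odd p -> beta \in coprime_quad p ->
    (forall nu : {rmorphism algC -> algC}, nu beta *+ 4 + 1 < p%:R) ->
    {in xs, forall x, x \in Aint /\
       x \in quad_adjoin (coprime_quad p) (sqrtC p%:R)} ->
    \sum_(x <- xs) x ^+ 2 = ((1 + sqrtC p%:R) / 2) ^+ 2 + beta ->
  exists2 x0, x0 \in xs & \sum_(x <- rem x0 xs) x ^+ 2 = beta.
Proof.
move=> p_pr p_odd Fbeta beta_lt Kxs; set s := sqrtC p%:R in Kxs *.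
have Dss : s ^+ 2 = p%:R by rewrite sqrtCK.
have Fp : p%:R \in coprime_quad p by rewrite rpred_nat.
have notFs := sqrt_notin_coprime_quad p_pr p_odd.
(* Coordinates are chosen as total functions, with the default (0, 0) outside [xs]. *)
have /choice[uw Duw] x : exists uw : algC * algC, x \in xs ->
    [/\ uw.1 \in coprime_quad p, uw.2 \in coprime_quad p, uw.2 \in Aint &
        x = (uw.1 + uw.2 * s) / 2].
  have [/Kxs[Zx Kx] | _] := boolP (x \in xs); last by exists (0, 0).
  by have [u [w Duw]] := Aint_quad_coprime p_pr p_odd Zx Kx; exists (u, w).
pose u x := (uw x).1; pose w x := (uw x).2.
have Fu x : x \in xs -> u x \in coprime_quad p by case/Duw.
have Fw x : x \in xs -> w x \in coprime_quad p by case/Duw.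
have Zw x : x \in xs -> w x \in Aint by case/Duw.
have Dx x : x \in xs -> x = (u x + w x * s) / 2 by case/Duw.
move=> Dsum.
(* The coordinates on 1 and [s] of four times the identity [Dsum]. *)
have [/eqP Dsum1 /eqP Dsum2] :
    \sum_(x <- xs) (u x ^+ 2 + w x ^+ 2 * p%:R) - (beta *+ 4 + 1 + p%:R) = 0 /\
    (\sum_(x <- xs) u x * w x) *+ 2 - 2 = 0.
  apply: (@quad_adjoin_eq0 (coprime_quad p) s) => //.
  - rewrite rpredB ?rpredD ?rpredMn ?rpred1 // big_seq rpred_sum // => x xs_x.
    by rewrite rpredD ?rpredX ?Fu // rpredM // rpredX ?Fw.
  - rewrite rpredB ?rpredMn ?rpred1 // big_seq rpred_sum // => x xs_x.
    by rewrite rpredM ?Fu ?Fw.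
  have : (\sum_(x <- xs) x ^+ 2) *+ 4 = (((1 + s) / 2) ^+ 2 + beta) *+ 4.
    by rewrite Dsum.
  have -> : (\sum_(x <- xs) x ^+ 2) *+ 4
      = \sum_(x <- xs) (u x ^+ 2 + w x ^+ 2 * p%:R)
        + (\sum_(x <- xs) u x * w x) *+ 2 * s.
    rewrite -!sumrMnl mulr_suml -big_split /= big_seq [RHS]big_seq.
    by apply: eq_bigr => x /Dx{1}->; rewrite -Dss; field.
  move: (\sum_(x <- xs) (_ + _)) (\sum_(x <- xs) (_ * _)) => A B DAB.
  transitivity (A + B *+ 2 * s - (((1 + s) / 2) ^+ 2 + beta) *+ 4).
    by rewrite -Dss; field.
  by rewrite DAB subrr.
move: Dsum1; rewrite subr_eq0 => /eqP Dsum1.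
have {}Dsum2 : \sum_(x <- xs) u x * w x = 1.
  by move: Dsum2; rewrite subr_eq0 -[2]/(1 *+ 2) eqrMn2r => /eqP.
have sqr_w_ge0 (nu : {rmorphism algC -> algC}) x : x \in xs -> 0 <= nu (w x) ^+ 2.
  by move=> /Fw Fwx; rewrite -realEsqr (coprime_quad_real nu Fwx).
have sum_lt2 (nu : {rmorphism algC -> algC}) : \sum_(x <- xs) nu (w x) ^+ 2 < 2.
  apply: aut_sum_sqr_lt2 (prime_gt0 p_pr) _ Dsum1 (beta_lt nu) => x xs_x.
  by split; [exact: Fu | exact: Fw].
have [x0 xs_x0 nz_w0] : exists2 x0, x0 \in xs & w x0 != 0.
  apply/hasP; apply: contra_eqT Dsum2 => /hasPn w0.
  rewrite big1_seq ?(eq_sym 0) ?oner_neq0 // => x /= /w0.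
  by rewrite negbK => /eqP->; rewrite mulr0.
(* [rem] deletes a single occurrence, so a repeated entry [x = x0] is covered as well. *)
have w0_rem x : x \in rem x0 xs -> w x = 0.
  move=> rem_x; apply/eqP; apply: contraT => nz_w1.
  have xs_x := mem_rem rem_x.
  have [||nu nu_ge1] := @Aint_aut_norm_ge1 (w x0 * w x).
  - by rewrite rpredM ?Zw.
  - by rewrite mulf_neq0.
  have := sum_lt2 nu; rewrite (big_rem x0) //= (big_rem x) //= addrA.
  have {}sum_ge0 : 0 <= \sum_(y <- rem x (rem x0 xs)) nu (w y) ^+ 2.
    by rewrite big_seq sumr_ge0 // => y /mem_rem/mem_rem; apply: sqr_w_ge0.
  have := sqr_w_ge0 nu x0 xs_x0; have := sqr_w_ge0 nu x xs_x.
  have : 1 <= nu (w x0) ^+ 2 * nu (w x) ^+ 2.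
    have Rw y : y \in xs -> nu (w y) \is Num.real.
      by move=> /Fw Fwy; apply: coprime_quad_real Fwy.
    rewrite -exprMn -rmorphM -real_normK ?exprn_ege1 //.
    by rewrite rmorphM rpredM ?Rw.
  move: (nu (w x0) ^+ 2) (nu (w x) ^+ 2) => A B AB_ge1 B_ge0 A_ge0.
  move=> ltAB; have {ltAB} : A + B < 2 by apply: le_lt_trans ltAB; rewrite lerDl.
  have AB_real : A - B \is Num.real by rewrite rpredB ?ger0_real.
  (* Arithmetic-geometric mean: (A + B)^2 = 4 A B + (A - B)^2 is at least 4. *)
  suff le2 : 2 <= A + B by move/(le_lt_trans le2); rewrite ltxx.
  rewrite -(@ler_pXn2r _ 2) ?nnegrE ?addr_ge0 ?ler0n //.
  have -> : (A + B) ^+ 2 = (A * B) *+ 4 + (A - B) ^+ 2 by ring.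
  have -> : 2 ^+ 2 = 1 *+ 4 + 0 :> algC by ring.
  by rewrite lerD ?ler_pMn2r // -realEsqr.
(* Every conjugate of w0^2 lies strictly between 0 and 2, so every conjugate of w0^2 - 1 has modulus
   below 1. *)
have ww0 : w x0 ^+ 2 = 1.
  apply/eqP; rewrite -subr_eq0; apply: contraT => nz_ww1.
  have [||nu] := @Aint_aut_norm_ge1 (w x0 ^+ 2 - 1) => //.
    by rewrite rpredB ?rpred1 ?rpredX ?Zw.
  rewrite rmorphB rmorphXn rmorph1.
  have := sum_lt2 nu; rewrite (big_rem x0) //= big1_seq ?addr0; last first.
    by move=> x /= /w0_rem->; rewrite rmorph0 expr0n.
  have : 0 < nu (w x0) ^+ 2.
    by rewrite lt0r sqr_w_ge0 // andbT expf_eq0 /= fmorph_eq0.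
  move: (nu (w x0) ^+ 2) => A A_gt0 A_lt2; rewrite real_leNgt ?normr_real ?real1 //.
  rewrite real_ltr_norml ?rpredB ?real1 ?ger0_real ?ltW // => /negP[].
  by rewrite ltrBrDr addNr A_gt0 ltrBlDr.
have uw0 : u x0 = w x0.
  move: Dsum2; rewrite (big_rem x0) //= big1_seq ?addr0; last first.
    by move=> x /= /w0_rem->; rewrite mulr0.
  by move=> uw1; rewrite -[LHS]mulr1 -ww0 expr2 mulrA uw1 mul1r.
exists x0 => //; move: Dsum; rewrite (big_rem x0) //=.
suff -> : x0 ^+ 2 = w x0 ^+ 2 * ((1 + s) / 2) ^+ 2 by rewrite ww0 mul1r => /addrI.
by rewrite {1}(Dx x0) // uw0; field.
Qed.

(** * The sums attached to rapidly growing primes, and the induction *)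

Definition half_sqrt_sum (ps : seq nat) : algC :=
  \sum_(p <- ps) ((1 + sqrtC p%:R) / 2) ^+ 2.

(** The largest prime comes first, so that the induction on the list removes it first. The bound 4 *
    sumn ps' + 1 dominates all conjugates of 4 b' + 1, with b' the sum for ps'. *)
Fixpoint sparse_primes (ps : seq nat) : bool :=
  if ps is p :: ps' then
    [&& prime p, p %% 4 == 1, 4 * sumn ps' + 1 < p & sparse_primes ps']%N
  else true.

Lemma mem_sparse_primes ps q : sparse_primes ps -> q \in ps ->
  [/\ prime q, (q %% 4 == 1)%N & (q <= sumn ps)%N].
Proof.
elim: ps => // p ps IHps /= /and4P[p_pr p1 _ /IHps{}IHps].
rewrite inE => /orP[/eqP-> | /IHps[q_pr q1 le_q]]; first by rewrite leq_addr.
by rewrite q_pr q1 (leq_trans le_q) ?leq_addl.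
Qed.

Lemma odd_mod4 p : (p %% 4 == 1)%N -> odd p.
Proof. by move=> /eqP p1; rewrite (divn_eq p 4) p1 oddD oddM andbF. Qed.

Lemma half_sqrt_sum_coprime_quad p ps :
  sparse_primes (p :: ps) -> half_sqrt_sum ps \in coprime_quad p.
Proof.
move=> /= /and4P[_ _ lt_p sp_ps].
rewrite /half_sqrt_sum big_seq rpred_sum // => q ps_q.
have [q_pr _ le_q] := mem_sparse_primes sp_ps ps_q.
rewrite rpredX // rpred_div ?rpred_nat // rpredD ?rpred1 // coprime_quad_sqrt //.
rewrite gtnNdvd ?prime_gt0 // (leq_ltn_trans le_q) // (leq_trans _ lt_p) //.
by rewrite addn1 ltnS leqW ?leq_pmull.
Qed.

(** Termwise, with s = sqrt q at least 1, both (1 + s)^2 and (1 - s)^2 are at most (2 s)^2 = 4 q. *)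
Lemma aut_half_sqrt_sum_le ps (nu : {rmorphism algC -> algC}) :
  sparse_primes ps -> nu (half_sqrt_sum ps) *+ 4 <= (4 * sumn ps)%:R.
Proof.
elim: ps => [|q ps IHps] sp_ps.
  by rewrite /half_sqrt_sum big_nil rmorph0 mul0rn.
have /= /and4P[q_pr _ _ /IHps{}IHps] := sp_ps.
rewrite /half_sqrt_sum big_cons -/(half_sqrt_sum ps) rmorphD mulrnDl.
rewrite mulnDr natrD lerD //.
set s : algC := sqrtC q%:R.
have -> : nu (((1 + s) / 2) ^+ 2) *+ 4 = (1 + nu s) ^+ 2.
  by rewrite rmorphXn rmorphM rmorphD rmorph1 fmorphV rmorph_nat; field.
have q_ge1 : 1 <= q%:R :> algC by rewrite ler1n prime_gt0.
have s_ge1 : 1 <= s by rewrite -sqrtC1 ler_sqrtC ?nnegrE ?ler0n ?ler01.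
have -> : (4 * q)%:R = (s + s) ^+ 2 by rewrite natrM -(sqrtCK q%:R) -/s; ring.
have : nu s ^+ 2 = s ^+ 2 by rewrite -rmorphXn sqrtCK rmorph_nat.
have s_ge0 : 0 <= s by apply: le_trans s_ge1.
move/eqP; rewrite eqf_sqr => /pred2P[]->.
  by rewrite ler_pXn2r ?nnegrE ?addr_ge0 ?lerD2r.
rewrite -[(1 - s) ^+ 2]sqrrN opprB ler_pXn2r ?nnegrE ?subr_ge0 ?addr_ge0 //.
by rewrite lerD2l (le_trans _ s_ge0) // oppr_le0.
Qed.

(** Induction on [ps]: each prime uses up one entry of [xs]. *)
Lemma sum_sqr_size_ge (A : set nat) ps (xs : seq algC) : sparse_primes ps ->
  {in xs, forall x, x \in Aint /\
     x \in generated_subfield [set sqrtC (n%:R : algC) | n in A]%classic} ->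
  \sum_(x <- xs) x ^+ 2 = half_sqrt_sum ps -> (size ps <= size xs)%N.
Proof.
elim: ps xs => // p ps IHps xs sp_ps Kxs.
rewrite /half_sqrt_sum big_cons -/(half_sqrt_sum ps) => Dsum.
have /= /and4P[p_pr p1 lt_p sp_ps'] := sp_ps.
have [|nu|x xs_x|x0 xs_x0 Drem] := sum_sqr_rem_quad p_pr (odd_mod4 p1) _ _ _ Dsum.
- exact: half_sqrt_sum_coprime_quad.
- apply: (@le_lt_trans _ _ (4 * sumn ps + 1)%:R); last by rewrite ltr_nat.
  by rewrite natrD lerD2r aut_half_sqrt_sum_le.
- by have [Zx Kx] := Kxs x xs_x; split=> //; apply: generated_sqrt_quad Kx.
have := IHps (rem x0 xs) sp_ps' _ Drem.
rewrite size_rem // => le_ps.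
have xs_gt0 : (0 < size xs)%N by case: (xs) xs_x0.
by rewrite -(prednK xs_gt0) ltnS le_ps // => x /mem_rem/Kxs.
Qed.

(** It is a root of X^2 - X - (p - 1)/4, and (p - 1)/4 is [p %/ 4] here. *)
Lemma Aint_half_sqrt p : (p %% 4 == 1)%N -> (1 + sqrtC p%:R) / 2 \in Aint.
Proof.
move=> /eqP p1; set z := _ / 2.
have Dz : z ^+ 2 - z - (p %/ 4)%:R = 0.
  have : p%:R = (p %/ 4)%:R * 4 + 1 :> algC.
    by rewrite {1}(divn_eq p 4) p1 natrD natrM.
  have := sqrtCK (p%:R : algC); rewrite /z.
  move: (sqrtC _) => s Ds Dp.
  have -> : (p %/ 4)%:R = (s ^+ 2 - 1) / 4 by rewrite Ds Dp; field.
  by field.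
apply: (@root_monic_Aint ('X^2 - ('X + (p %/ 4)%:R%:P))).
- by apply/rootP; rewrite !hornerE -[RHS]Dz; ring.
- rewrite monicE lead_coefDl ?lead_coefXn // size_polyN size_polyXn.
  by rewrite size_XaddC.
- apply/polyOverP=> i; rewrite coefB coefXn coefD coefX coefC -mulrb.
  by rewrite rpredB ?rpred_nat // rpredD ?rpred_nat // rpredMn // rpred_nat.
Qed.

Lemma sparse_primes_exists (A : set nat) n :
  infinite_set (A `&` [set p : nat | prime p /\ p = 1 %[mod 4]])%classic ->
  exists ps, [/\ size ps = n, sparse_primes ps & {in ps, forall p, A p}].
Proof.
move=> infA; elim: n => [|n [ps [sz_ps sp_ps Aps]]]; first by exists [::].
have [p [[Ap [p_pr p1]] lt_p]] : exists p,
    (A `&` [set p : nat | prime p /\ p = 1 %[mod 4]])%classic p /\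
    (4 * sumn ps + 1 < p)%N.
  apply: contrapT => no_p; apply: infA.
  apply: sub_finite_set (finite_II (4 * sumn ps + 2)) => p Ap /=.
  rewrite addn2 ltnS leqNgt -addn1; apply/negP => lt_p; apply: no_p.
  by exists p.
exists (p :: ps); split=> /=; first by rewrite sz_ps.
  by rewrite p_pr p1 eqxx lt_p.
by move=> q; rewrite inE => /orP[/eqP-> | /Aps].
Qed.

(** * Passage between the ring of integers and [Aint], and the conclusion *)

Lemma ring_of_integers_Aint (A : set algC) (x : ring_of_integers (rat_adjoin A)) :
  val (val x) \in Aint.
Proof.
have /asboolP[q mon_q qx0] := valP x.
apply: (@root_monic_Aint (map_poly intr q)).
- move: qx0; rewrite -(fmorph_root (val : rat_adjoin A -> algC)) -map_poly_comp.
  by rewrite (@eq_map_poly _ _ _ intr) // => m; exact: rmorph_int.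
- exact: monic_map.
- by apply/polyOverP=> i; rewrite coef_map intr_int.
Qed.

Lemma ring_of_integers_lift (A : set algC) (y : algC) :
  y \in generated_subfield A -> y \in Aint ->
  exists z : ring_of_integers (rat_adjoin A), val (val z) = y.
Proof.
move=> Ay Zy; pose x : rat_adjoin A := Sub y Ay.
suff Zx : x \in integral_closure_pred (rat_adjoin A) by exists (Sub x Zx).
(* The minimal polynomial of [y] has integer coefficients and witnesses integrality. *)
have [q Dq] := floorpP Zy.
apply/asboolP; exists q.
  have := minCpoly_monic y; rewrite Dq !monicE lead_coef_map_inj //.
    by rewrite -[1 in X in X -> _]/(1%:~R) eqr_int.
  exact: intr_inj.
rewrite -(fmorph_root (val : rat_adjoin A -> algC)) -map_poly_comp.
rewrite (@eq_map_poly _ _ _ intr); last by move=> m; exact: rmorph_int.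
by rewrite -Dq; exact: root_minCpoly.
Qed.

Local Open Scope classical_set_scope.

Theorem theorem1p1 (S : set nat) :
  infinite_set (S `&` [set p : nat | prime p /\ p = 1 %[mod 4]]) ->
  pythagoras_number (ring_of_integers (multiquadratic_field S)) = None.
Proof.
move=> infS; rewrite /pythagoras_number; case: pselect => // h; exfalso.
case: h => N /asboolP eqN.
(* With N + 1 primes, the sum is one of N + 1 squares, hence by [eqN] of N squares, one fewer than
   [sum_sqr_size_ge] allows. *)
have [ps [sz_ps sp_ps Sps]] := sparse_primes_exists N.+1 infS.
have /choice[z Dz] p : exists z : ring_of_integers (multiquadratic_field S),
    p \in ps -> val (val z) = (1 + sqrtC p%:R) / 2.
  have [ps_p | _] := boolP (p \in ps); last by exists 0.
  have [_ p1 _] := mem_sparse_primes sp_ps ps_p.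
  have [||z Dz] := @ring_of_integers_lift
      [set sqrtC (n%:R : algC) | n in S]%classic ((1 + sqrtC p%:R) / 2).
  - rewrite rpred_div ?rpred_nat // rpredD ?rpred1 //.
    by apply/asboolP => F _; apply; exists p => //; apply: Sps.
  - exact: Aint_half_sqrt.
  - by exists z.
pose vv : ring_of_integers (multiquadratic_field S) -> algC := fun t => val (val t).
have vv_sum n (F : 'I_n -> ring_of_integers (multiquadratic_field S)) :
    vv (\sum_(i < n) F i ^+ 2) = \sum_(i < n) vv (F i) ^+ 2.
  by rewrite /vv !rmorph_sum; apply: eq_bigr => i _; rewrite !rmorphXn.
have : sum_sq (ring_of_integers (multiquadratic_field S)) N.+1
         (\sum_(i < N.+1) z (nth 0%N ps i) ^+ 2).
  by exists (fun i : 'I_N.+1 => z (nth 0%N ps i)).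
rewrite -eqN => -[x /(congr1 vv)]; rewrite !vv_sum => Dsum.
suff : (size ps <= size [seq vv (x i) | i <- enum 'I_N])%N.
  by rewrite size_map size_enum_ord sz_ps ltnn.
apply: (@sum_sqr_size_ge S) => //.
  move=> _ /mapP[i _ ->]; split; first exact: ring_of_integers_Aint.
  exact: valP (val (x i)).
rewrite big_map big_enum -Dsum /half_sqrt_sum (big_nth 0%N) big_mkord sz_ps.
by apply: eq_bigr => i _; rewrite /vv Dz // mem_nth // sz_ps.
Qed.
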